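(* Let $\mathcal{H}$ be a real Hilbert space and let $A:\mathcal{H}\to 2^{\mathcal{H}}$ be maximally monotone with $\operatorname{zer}A\neq\varnothing$. Let $x_0\in\mathcal{H}$, let $(\lambda_k)_{k\in\mathbb{N}}$ be in $\left]0,2\right[$, $(\eta_k)_{k\in\mathbb{N}}$ in $\mathbb{R}_+$, $(c_k)_{k\in\mathbb{N}}$ in $\mathbb{R}_{++}$, $(e_k)_{k\in\mathbb{N}}$ in $\mathcal{H}$, and let $$(\forall k\in\mathbb{N})\quad x_{k+1}=(1-\lambda_k)x_k+\lambda_k \operatorname{J}_{c_kA}x_k+\eta_ke_k .$$ Suppose that $A^{-1}$ is Lipschitz continuous at $0$ with modulus $\alpha>0$, i.e., $A^{-1}(0)=\{\bar{x}\}$ and there exists $\tau>0$ such that $\|x-\bar{x}\|\leq\alpha\|w\|$ for every $(w,x)\in\operatorname{gra}A^{-1}$ with $w\in B[0;\tau]$. Suppose that $\sum_{k\in\mathbb{N}}\eta_k\|e_k\|<\infty$. Let $(\varepsilon_k)_{k\in\mathbb{N}}$ be in $\mathbb{R}_+$ such that $\eta_k\varepsilon_k\to0$. Suppose that $(\forall k\in\mathbb{N})$ $\|e_k\|\leq\varepsilon_k\|x_k-x_{k+1}\|$, that $\liminf_{k\to\infty}c_k>0$, and that $0<\liminf_{k\to\infty}\lambda_k\leq\limsup_{k\to\infty}\lambda_k<2$. Set $$(\forall k\in\mathbb{N})\quad \rho_k:=\max\left\{\left(1-\frac{\lambda_k}{\frac{\alpha}{c_k}+1}\right)^2,\ 1-\lambda_k(2-\lambda_k)\frac{1}{1+\frac{\alpha^2}{c_k^2}}\right\}^{1/2}.$$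 Then the following hold. (i) For every $k$ large enough, $\|x_{k+1}-\bar{x}\|\leq\frac{\rho_k+\eta_k\varepsilon_k}{1-\eta_k\varepsilon_k}\|x_k-\bar{x}\|$. (ii) There exist $\mu\in[0,1[$ and $K\in\mathbb{N}$ such that $(\forall k\geq K)$ $\|x_{k+1}-\bar{x}\|\leq\mu\|x_k-\bar{x}\|\leq\mu^{k-K+1}\|x_K-\bar{x}\|$.
   Context: $\mathbb{N}=\{0,1,2,\ldots\}$; $\mathbb{R}_+$ and $\mathbb{R}_{++}$ are the nonnegative and positive reals. $\operatorname{zer}A=A^{-1}(0)=\{x\in\mathcal{H}:0\in Ax\}$, and $\operatorname{gra}A^{-1}=\{(w,x)\in\mathcal{H}\times\mathcal{H}:w\in Ax\}$. The resolvent is $\operatorname{J}_{\gamma A}=(\operatorname{Id}+\gamma A)^{-1}$, which for maximally monotone $A$ and $\gamma>0$ is single-valued with full domain. $B[0;\tau]$ is the closed ball of center $0$ and radius $\tau$. *)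

(* Defs.v *)
From mathcomp Require Import all_boot all_order all_algebra.
From mathcomp Require Import sesquilinear.
From mathcomp Require Import all_classical all_reals all_analysis.

Set Implicit Arguments.
Unset Strict Implicit.
Unset Printing Implicit Defensive.

Import Order.TTheory GRing.Theory Num.Theory.
Import numFieldNormedType.Exports.

Local Open Scope classical_set_scope.
Local Open Scope ring_scope.

Section SetValuedOperators.
Context {R : realType} {H : completeNormedModType R}.

(* A set-valued operator H -> 2^H is a function A : H -> set H; u is in A x
   iff the proposition A x u holds. *)
Implicit Types A B : H -> set H.

Definition gra A : set (H * H) := [set p | A p.1 p.2].

Definition inverse A : H -> set H := fun u => [set x | gra A (x, u)].

Definition zer A : set H := inverse A 0.

Definition monotone (ip : {dot H for idfun}) A : Prop :=
  forall x u y v, gra A (x, u) -> gra A (y, v) -> 0 <= ip (x - y) (u - v).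

Definition maximally_monotone (ip : {dot H for idfun}) A : Prop :=
  monotone ip A /\ ~ exists B, monotone ip B /\ gra A `<` gra B.

Definition resolvent_rel (gamma : R) A : H -> set H :=
  inverse (fun x => [set x + gamma *: u | u in A x]).

(* By Minty's theorem, resolvent_rel gamma A x is a singleton for every x when
   A is maximally monotone and 0 < gamma, so the default value 0 that
   fun_of_rel takes on empty images plays no role there. *)
Definition resolvent (gamma : R) A : H -> H :=
  fun_of_rel (fun=> 0) (resolvent_rel gamma A).

Definition lipschitz_at0 (T : H -> set H) (alpha : R) (xbar : H) : Prop :=
  T 0 = [set xbar] /\
  exists2 tau : R, 0 < tau & forall w x, gra T (w, x) -> `|w| <= tau ->
    `|x - xbar| <= alpha * `|w|.

End SetValuedOperators.

(* Main.v *)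
(* Minty's theorem makes the resolvent J_k = J_{c_k A} x_k satisfy
   (x_k - J_k) / c_k in A J_k; it is obtained by minimizing
   t + (|x|^2 + |u|^2) / 2 over the epigraph of the Fitzpatrick function of A,
   where strong convexity makes minimizing sequences Cauchy.  Monotonicity at
   xbar makes (x_k) quasi-Fejer monotone, so that x_k - J_k -> 0 and
   (x_k - J_k) / c_k eventually enters the ball where A^-1 is Lipschitz at 0,
   i.e., |J_k - xbar| <= (alpha / c_k) |x_k - J_k|.  A two-vector estimate then
   shows that the exact relaxed step contracts by rho_k, and the error is
   absorbed through |e_k| <= eps_k (|x_k - xbar| + |x_{k+1} - xbar|). *)
Require Import Defs.
From mathcomp Require Import all_boot all_order all_algebra.
From mathcomp Require Import sesquilinear ring lra.
From mathcomp Require Import all_classical all_reals all_analysis.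

Set Implicit Arguments.
Unset Strict Implicit.
Unset Printing Implicit Defensive.

Import Order.TTheory GRing.Theory Num.Theory.
Import numFieldNormedType.Exports.

Local Open Scope classical_set_scope.
Local Open Scope ring_scope.

(** * Inner product: polarization, continuity, completeness *)

Section InnerProduct.
Context {R : realType} {H : completeNormedModType R} (ip : {dot H for idfun}).
Context (norm_ip : forall z : H, `|z| ^+ 2 = ip z z).

Lemma ipC (u v : H) : ip u v = ip v u.
Proof. by rewrite hermC expr0 mul1r. Qed.

Lemma ip0l (v : H) : ip 0 v = 0.
Proof. exact: linear0l. Qed.

Lemma ipDl (u v w : H) : ip (u + v) w = ip u w + ip v w.
Proof. exact: linearDl. Qed.

Lemma ipNl (u v : H) : ip (- u) v = - ip u v.
Proof. exact: linearNl. Qed.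

Lemma ipZl (a : R) (u v : H) : ip (a *: u) v = a * ip u v.
Proof. exact: linearZl_LR. Qed.

Lemma ipDr (u v w : H) : ip w (u + v) = ip w u + ip w v.
Proof. by rewrite ipC ipDl !(ipC w). Qed.

Lemma ipNr (u v : H) : ip v (- u) = - ip v u.
Proof. by rewrite ipC ipNl (ipC v). Qed.

Lemma ipZr (a : R) (u v : H) : ip v (a *: u) = a * ip v u.
Proof. by rewrite ipC ipZl (ipC v). Qed.

Definition ipE := (ipDl, ipDr, ipNl, ipNr, ipZl, ipZr).

Lemma ip_ge0 (z : H) : 0 <= ip z z.
Proof. by rewrite -norm_ip exprn_ge0. Qed.

Lemma ip_polar (u v : H) : ip u v = (`|u + v| ^+ 2 - `|u| ^+ 2 - `|v| ^+ 2) / 2.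
Proof. by rewrite !norm_ip !ipE (ipC v u); field. Qed.

Lemma ip_le_norm (u v : H) : ip u v <= `|u| * `|v|.
Proof.
have : `|u + v| ^+ 2 <= (`|u| + `|v|) ^+ 2.
  by rewrite ler_sqr ?nnegrE ?addr_ge0// ler_normD.
by rewrite sqrrD ip_polar => h; lra.
Qed.

Lemma cvg_ip (f : nat -> H) (l b : H) : f @ \oo --> l ->
  ip (f n) b @[n --> \oo] --> ip l b.
Proof.
move=> fl; rewrite ip_polar; under eq_fun do rewrite ip_polar.
apply: cvgMl; apply: cvgB; last exact: cvg_cst.
apply: cvgB; rewrite ?expr2; apply: cvgM; apply: cvg_norm => //;
  by apply: cvgD => //; exact: cvg_cst.
Qed.

(** This is the form in which strong convexity controls a minimizing sequence: [d n] stands for the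
    excess of the [n]-th value over the infimum. *)
Lemma cauchy_seq_sqr_dist (f : nat -> H) (d : nat -> R) :
  d @ \oo --> 0 -> (forall n m, `|f n - f m| ^+ 2 <= d n + d m) ->
  cvgn f.
Proof.
move=> d0 fd; apply: cauchy_cvg; apply: cauchy_exP => e e0.
have /cvgrPdist_lt /(_ (e ^+ 2 / 2)) : d @ \oo --> (0 : R) by [].
case=> [|N _ hN]; first by rewrite divr_gt0// exprn_gt0.
exists (f N); exists N => // n /= Nn; rewrite -ball_normE /=.
rewrite -ltr_sqr ?nnegrE ?(ltW e0)//; apply: (le_lt_trans (fd _ _)).
have := hN _ Nn; have := hN N (leqnn N).
by rewrite !sub0r !normrN => /ltr_normlW ? /ltr_normlW ?; lra.
Qed.

(** * Minty's theorem through the Fitzpatrick function *)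

Section Minty.
Context (G : H -> H -> Prop).
Context (monoG : forall x u y v, G x u -> G y v -> 0 <= ip (x - y) (u - v)).
Context (maxG : forall x u,
  (forall a b, G a b -> 0 <= ip (x - a) (u - b)) -> G x u).

(* The epigraph of the Fitzpatrick function
   [F (x, u) = sup_(G a b) (<x, b> + <a, u> - <a, b>)]. *)
Let epiF (x u : H) (t : R) :=
  forall a b, G a b -> ip x b + ip a u - ip a b <= t.

Let energy (x u : H) (t : R) := t + (ip x x + ip u u) / 2.

Let epiF_graph x u : G x u -> epiF x u (ip x u).
Proof.
move=> Gxu a b Gab; have := monoG Gxu Gab.
by rewrite !ipE; lra.
Qed.

(** If [t < ip x u], then [(x, u)] is monotonically related to [G], hence lies in [G] by maximality;
    testing [epiF] at [(x, u)] itself gives a contradiction. *)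
Let epiF_ge x u t : epiF x u t -> ip x u <= t.
Proof.
move=> Et; rewrite leNgt; apply/negP => lt_t.
have Gxu : G x u.
  apply: maxG => a b Gab; have := Et _ _ Gab.
  by rewrite !ipE; lra.
by have := Et _ _ Gxu; lra.
Qed.

Let epiF_convex (s : R) x u t y v r : 0 <= s <= 1 ->
  epiF x u t -> epiF y v r ->
  epiF ((1 - s) *: x + s *: y) ((1 - s) *: u + s *: v) ((1 - s) * t + s * r).
Proof.
move=> /andP[s0 s1] E1 E2 a b Gab.
rewrite !ipE.
have h1 : 0 <= (1 - s) * (t - (ip x b + ip a u - ip a b)).
  by rewrite mulr_ge0 ?subr_ge0// E1.
have h2 : 0 <= s * (r - (ip y b + ip a v - ip a b)).
  by rewrite mulr_ge0 ?subr_ge0// E2.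
lra.
Qed.

Let energy_ge0 x u t : epiF x u t -> 0 <= energy x u t.
Proof.
move/epiF_ge => h; rewrite /energy.
have : 0 <= ip (x + u) (x + u) by exact: ip_ge0.
by rewrite !ipE (ipC u x); lra.
Qed.

(** The exact quadratic defect serves twice: [s = 1/2] gives the Cauchy estimate, small [s] the
    first-order condition at the minimizer. *)
Let energy_convex (s : R) x u t y v r :
  energy ((1 - s) *: x + s *: y) ((1 - s) *: u + s *: v) ((1 - s) * t + s * r)
  = (1 - s) * energy x u t + s * energy y v r
    - s * (1 - s) / 2 * (ip (x - y) (x - y) + ip (u - v) (u - v)).
Proof.
rewrite /energy !ipE (ipC y x) (ipC v u).
by field.
Qed.

Let energy_min a0 b0 : G a0 b0 -> exists x u t, epiF x u t /\
  forall y v r, epiF y v r -> energy x u t <= energy y v r.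
Proof.
move=> G0.
pose S : set R := [set m | exists x u t, epiF x u t /\ m = energy x u t].
have infS : has_inf S.
  split; first by exists (energy a0 b0 (ip a0 b0)), a0, b0, (ip a0 b0);
    split => //; exact: epiF_graph.
  by exists 0 => _ [x [u [t [Et ->]]]]; exact: energy_ge0.
have leS y v r : epiF y v r -> inf S <= energy y v r.
  by move=> E; apply: ge_inf; [case: infS|exists y, v, r].
pose d n : R := n.+1%:R^-1.
have d0 : d @ \oo --> (0 : R) by exact: cvg_harmonic.
have /choice[z hz] n : exists z : H * H * R,
    epiF z.1.1 z.1.2 z.2 /\ energy z.1.1 z.1.2 z.2 <= inf S + d n.
  have dn0 : 0 < d n by rewrite invr_gt0.
  have [_ [x [u [t [Et ->]]]] lt_m] := inf_adherent dn0 infS.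
  by exists (x, u, t); split => //; exact: ltW.
have half : 0 <= (2^-1 : R) <= 1 by apply/andP; split; lra.
(* The midpoint has energy at least [inf S], and the defect there has coefficient 1/8, whence the
   factor 4 = 8/2. *)
have close n m : ip ((z n).1.1 - (z m).1.1) ((z n).1.1 - (z m).1.1)
    + ip ((z n).1.2 - (z m).1.2) ((z n).1.2 - (z m).1.2)
    <= 4 * d n + 4 * d m.
  have [E1 h1] := hz n; have [E2 h2] := hz m.
  have := leS _ _ _ (epiF_convex half E1 E2).
  by rewrite energy_convex; lra.
have d40 : (fun n => 4 * d n) @ \oo --> (0 : R).
  by rewrite -(mulr0 4); apply: cvgMr.
have /(cauchy_seq_sqr_dist d40) cx n m :
    `|(z n).1.1 - (z m).1.1| ^+ 2 <= 4 * d n + 4 * d m.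
  rewrite norm_ip; apply: le_trans (close n m).
  by rewrite lerDl ip_ge0.
have /(cauchy_seq_sqr_dist d40) cu n m :
    `|(z n).1.2 - (z m).1.2| ^+ 2 <= 4 * d n + 4 * d m.
  rewrite norm_ip; apply: le_trans (close n m).
  by rewrite lerDr ip_ge0.
have /cvg_ex[x zx] := cx.
have /cvg_ex[u zu] := cu.
(* The third coordinate is chosen to make the energy exactly [inf S]; membership in the epigraph
   then follows by passing to the limit in [f n <= g n]. *)
exists x, u, (inf S - (ip x x + ip u u) / 2); split; last first.
  by move=> y v r E; rewrite {1}/energy subrK; exact: leS.
move=> a b Gab; rewrite (ipC a).
pose f n := ip (z n).1.1 b + ip (z n).1.2 a - ip a b.
pose g n := inf S + d n - (`|(z n).1.1| ^+ 2 + `|(z n).1.2| ^+ 2) / 2.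
have cf : f @ \oo --> ip x b + ip u a - ip a b.
  by apply: cvgB; [apply: cvgD; exact: cvg_ip|exact: cvg_cst].
have cg : g @ \oo --> inf S + 0 - (`|x| ^+ 2 + `|u| ^+ 2) / 2.
  apply: cvgB; first by apply: cvgD => //; exact: cvg_cst.
  by apply: cvgMl; apply: cvgD; rewrite expr2; apply: cvgM; exact: cvg_norm.
rewrite -!norm_ip -(addr0 (inf S)).
apply: (ler_cvg_to cf cg); apply: nearW => n; rewrite /f /g.
have [/(_ _ _ Gab) h1] := hz n; rewrite /energy !norm_ip (ipC _ a); lra.
Qed.

(* At the minimizer (x, u, t) of the energy over the epigraph, the first-order
   condition says exactly that (- u, - x) is monotonically related to G. *)
Lemma minty_zero a0 b0 : G a0 b0 -> exists p, G p (- p).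
Proof.
move=> G0; have [x [u [t [Et min_t]]]] := energy_min G0.
have opt a b : G a b ->
    0 <= ip a b - t + ip x (a - x) + ip u (b - u).
  move=> Gab; have Eab := epiF_graph Gab.
  set D := ip (x - a) (x - a) + ip (u - b) (u - b).
  have D0 : 0 <= D by rewrite addr_ge0 ?ip_ge0.
  have -> : ip a b - t + ip x (a - x) + ip u (b - u)
      = energy a b (ip a b) - energy x u t - D / 2.
    rewrite /D /energy !ipE (ipC a x) (ipC b u).
    by field.
  set Q := energy a b _ - _.
  apply/ler_addgt0Pr => e e0.
  (* Minimality along the segment gives [Q >= (1 - s) / 2 * D]; this [s] lies in ]0, 1] and makes
     [s * D <= e]. *)
  pose s : R := e / (e + D + 1).
  have den : 0 < e + D + 1 by lra.
  have s0 : 0 < s by rewrite divr_gt0.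
  have s1 : s <= 1 by rewrite ler_pdivrMr// mul1r; lra.
  have := min_t _ _ _ (epiF_convex (s := s) _ Et Eab).
  rewrite energy_convex -/D (ltW s0) s1 => /(_ isT) h.
  have h1 : s * ((1 - s) / 2 * D) <= s * Q by rewrite /Q; lra.
  rewrite ler_pM2l// in h1.
  have sD : s * D <= e.
    by rewrite /s mulrAC ler_pdivrMr// ler_pM2l//; lra.
  lra.
have Gux : G (- u) (- x).
  apply: maxG => a b Gab; have := opt _ _ Gab; have := epiF_ge Et.
  have := ip_ge0 (x + u).
  by rewrite !ipE (ipC u x) (ipC a x); lra.
(* Testing [opt] at the new pair [(- u, - x)] gives [|x + u|^2 <= 0]. *)
have ux0 : x + u = 0.
  apply/eqP; rewrite -normr_eq0 -sqrf_eq0 eq_le exprn_ge0// andbT norm_ip.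
  have := opt _ _ Gux; have := epiF_ge Et.
  by rewrite !ipE (ipC u x); lra.
by exists x; move: Gux; have -> : - u = x
  by apply/eqP; rewrite eq_sym -addr_eq0 ux0.
Qed.

End Minty.

(** * From maximality to the resolvent inclusion *)

Context (A : H -> set H).
Context (maxA : maximally_monotone ip A).

(** Otherwise adjoining the single pair [(x, u)] would properly extend the graph of [A]
    monotonically. *)
Lemma maximally_monotone_related x u :
  (forall a b, A a b -> 0 <= ip (x - a) (u - b)) -> A x u.
Proof.
move=> rel; apply: contrapT => nAxu; case: maxA => monoA; apply.
exists (fun y => [set v | A y v \/ (y = x /\ v = u)]); split; last first.
  split; first by move=> [y v] /= h; left.
  by move=> /(_ (x, u)) h; apply/nAxu/h; right.
move=> y v y' v' [Ayv|[/= -> ->]] [Ay'v'|[/= -> ->]].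
- exact: monoA.
- have := rel _ _ Ayv; rewrite /= -opprB -(opprB v) ipNl ipNr opprK.
  by [].
- exact: rel.
- by rewrite subrr ip0l.
Qed.

Lemma minty (g : R) (z : H) : 0 < g -> zer A !=set0 ->
  exists p, A p (g^-1 *: (z - p)).
Proof.
move=> g0 [a0 Aa0].
have g0' : g != 0 by rewrite gt_eqF.
(* [G] is the graph of [g A - z], so [G p (- p)] is exactly the wanted inclusion. *)
pose G (a v : H) := A a (g^-1 *: (v + z)).
have monoG a v b w : G a v -> G b w -> 0 <= ip (a - b) (v - w).
  move=> Ga Gb; have := maxA.1 _ _ _ _ Ga Gb.
  by rewrite -scalerBr opprD addrACA subrr addr0 ipZr pmulr_rge0 ?invr_gt0.
have maxG a v : (forall b w, G b w -> 0 <= ip (a - b) (v - w)) -> G a v.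
  move=> rel; apply: maximally_monotone_related => b w Abw.
  have := rel b (g *: w - z); rewrite /G subrK scalerK// => /(_ Abw).
  have -> : v - (g *: w - z) = g *: (g^-1 *: (v + z) - w).
    by rewrite scalerBr scalerA divff// scale1r opprB addrA addrAC.
  by rewrite ipZr pmulr_rge0.
have G0 : G a0 (- z) by rewrite /G addNr scaler0.
have [p Gp] := minty_zero monoG maxG G0.
by exists p; move: Gp; rewrite /G addrC.
Qed.

Lemma resolventP (g : R) (z : H) : 0 < g -> zer A !=set0 ->
  A (resolvent g A z) (g^-1 *: (z - resolvent g A z)).
Proof.
move=> g0 A0; have g0' : g != 0 by rewrite gt_eqF.
have [p Ap] := minty z g0 A0.
have : resolvent_rel g A z (resolvent g A z).
  apply: fun_of_relP; exists p; exists (g^-1 *: (z - p)) => //.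
  by rewrite scalerA divff// scale1r addrC subrK.
move: (resolvent g A z) => q [u Aqu /= <-].
by rewrite (addrC q) addrK scalerK.
Qed.
End InnerProduct.

(** * The contraction factor and its uniform bound *)

Section Rate.
Context {R : realType}.
Implicit Types b lam : R.

(* rho_k is [rate (alpha / c_k) lambda_k]. *)
Definition rate b lam : R := Num.sqrt (Num.max
  ((1 - lam / (b + 1)) ^+ 2)
  (1 - lam * (2 - lam) * (1 / (1 + b ^+ 2)))).

Lemma sqr_rate b lam : rate b lam ^+ 2 = Num.max
  ((1 - lam / (b + 1)) ^+ 2)
  (1 - lam * (2 - lam) * (1 / (1 + b ^+ 2))).
Proof. by rewrite sqr_sqrtr// le_max sqr_ge0. Qed.

Lemma rate_le (l h B : R) : 0 < l -> h < 2 -> 0 <= B ->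
  exists2 r, 0 <= r < 1 & forall b lam,
    0 <= b <= B -> l <= lam <= h -> rate b lam <= r.
Proof.
move=> l0 h2 B0.
(* [m] bounds [|1 - lam / (b + 1)|]: from above the extreme case is [lam = l], [b = B], from below
   it is [lam = h], [b = 0]. *)
pose m := Num.max 0 (Num.max (1 - l / (B + 1)) (h - 1)).
pose n := 1 - l * (2 - h) * (1 / (1 + B ^+ 2)).
have B1 : 0 < B + 1 by lra.
have B2 : 0 < 1 + B ^+ 2 by rewrite ltr_pwDl// sqr_ge0.
have m0 : 0 <= m by rewrite /m le_max lexx.
have m1 : m < 1.
  rewrite /m !gt_max ltr01/=; apply/andP; split; last lra.
  by rewrite ltrBlDr ltrDl divr_gt0.
have n1 : n < 1.
  by rewrite /n ltrBlDr ltrDl !mulr_gt0 ?subr_gt0// invr_gt0.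
exists (Num.sqrt (Num.max (m ^+ 2) n)).
  rewrite sqrtr_ge0/= -sqrtr1 ltr_sqrt// gt_max n1 andbT.
  by rewrite expr_lt1.
move=> b lam /andP[b0 bB] /andP[llam lamh].
have b1 : 0 < b + 1 by lra.
apply: ler_wsqrtr; rewrite ge_max !le_max; apply/andP; split; apply/orP.
- left; rewrite -(real_normK (num_real (1 - _))).
  rewrite ler_sqr ?nnegrE// ler_norml; apply/andP; split.
    rewrite lerNl opprB; apply: (@le_trans _ _ (h - 1)).
      rewrite lerD2r; apply: le_trans lamh.
      by rewrite ler_pdivrMr// ler_peMr; lra.
    by rewrite /m !le_max lexx !orbT.
  apply: (@le_trans _ _ (1 - l / (B + 1))); last first.
    by rewrite /m !le_max lexx !orbT.
  rewrite lerD2l lerN2; apply: ler_pM => //; first exact: ltW.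
    by rewrite invr_ge0 ltW.
  by rewrite lef_pV2 ?posrE// lerD2r.
- right; rewrite /n lerD2l lerN2; apply: ler_pM.
  + by apply: mulr_ge0; lra.
  + by rewrite divr_ge0// ltW.
  + by apply: ler_pM; lra.
  + have bb : 0 < 1 + b ^+ 2 by rewrite ltr_pwDl// sqr_ge0.
    by rewrite !mul1r lef_pV2 ?posrE// lerD2l ler_sqr ?nnegrE//; lra.
Qed.

End Rate.

(** * Eventual bounds from upper and lower limits; quasi-monotone sequences *)

Section LimitBounds.
Context {R : realType}.
Implicit Types (u : nat -> R) (y : R).

Lemma limn_esup_lt_near u y : (limn_esup (fun k => (u k)%:E) < y%:E)%E ->
  exists2 z, z < y & \forall k \near \oo, u k <= z.
Proof.
rewrite /limn_esup limf_esupE => /ereal_inf_lt[_ [V FV <-] supV].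
have [n Vn] : exists n, V n by apply: filter_ex FV.
have ub k : V k -> ((u k)%:E <= ereal_sup ((fun k => (u k)%:E) @` V))%E.
  by move=> Vk; apply: ereal_sup_ubound; exists k.
(* The supremum is finite, lying between [u n] and [y], and serves as the witness. *)
have := ub n Vn; move: supV ub; case: ereal_sup => [s| |]//.
rewrite lte_fin => sy ub _; exists s => //.
by apply: filterS FV => k /ub; rewrite lee_fin.
Qed.

Lemma limn_einf_gt_near u y : (y%:E < limn_einf (fun k => (u k)%:E))%E ->
  exists2 z, y < z & \forall k \near \oo, z <= u k.
Proof.
rewrite /limn_einf lteNr => h.
have [|z zy nz] := @limn_esup_lt_near (fun k => - u k) (- y); first exact: h.
exists (- z); first by rewrite ltrNr.
by apply: filterS nz => k; rewrite lerNl.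
Qed.

(** Subtracting the partial sums of [d] from [a] leaves a nonincreasing sequence bounded below by
    minus the sum of [d]. *)
Lemma quasi_nonincreasing_is_cvgn (a d : nat -> R) :
  (forall k, 0 <= a k) -> (forall k, 0 <= d k) -> cvgn (series d) ->
  (forall k, a k.+1 <= a k + d k) -> cvgn a.
Proof.
move=> a0 d0 cd ad.
have -> : a = (a \- series d) \+ series d by apply/funext => k /=; rewrite subrK.
apply: is_cvgD => //; apply: nonincreasing_is_cvgn.
  apply/nonincreasing_seqP => k /=; rewrite /series /= big_nat_recr//=.
  by have := ad k; lra.
exists (- limn (series d)) => _ [k _ <-] /=.
apply: (@le_trans _ _ (- series d k)); last by rewrite lerDr.
rewrite lerN2; apply: nondecreasing_cvgn_le => //.
by apply/nondecreasing_seqP => n; rewrite /series /= big_nat_recr//= lerDl.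
Qed.

End LimitBounds.

(** * Contraction of the exact relaxed step *)

Section Step.
Context {R : realType} {H : completeNormedModType R} (ip : {dot H for idfun}).
Context (norm_ip : forall z : H, `|z| ^+ 2 = ip z z).

Lemma sqr_norm_add (p w : H) (q : R) :
  `|p + q *: w| ^+ 2 = `|p| ^+ 2 + 2 * q * ip p w + q ^+ 2 * `|w| ^+ 2.
Proof. by rewrite !norm_ip !ipE (ipC ip w p); ring. Qed.

(** For [p = J_k - xbar] and [w = x_k - J_k], [p + w] and [p + (1 - lam) *: w] are the errors before
    and after the exact step. *)
Lemma relaxed_step_le (p w : H) (b lam : R) : 0 <= b -> 0 < lam < 2 ->
  0 <= ip p w -> `|p| <= b * `|w| ->
  `|p + (1 - lam) *: w| <= rate b lam * `|p + w|.
Proof.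
move=> b0 /andP[lam0 lam2] pw pbw.
rewrite -ler_sqr ?nnegrE ?mulr_ge0 ?sqrtr_ge0// exprMn sqr_rate.
have := sqr_norm_add p w 1; rewrite scale1r => ->; rewrite sqr_norm_add.
have s_le := ip_le_norm norm_ip p w.
set P := `|p| in pbw s_le *; set W := `|w| in pbw s_le *.
set s := ip p w in pw s_le *.
have P0 : 0 <= P by rewrite /P.
have W0 : 0 <= W by rewrite /W.
set N := P ^+ 2 + 2 * 1 * s + 1 ^+ 2 * W ^+ 2.
have N0 : 0 <= N by have := sqr_ge0 P; have := sqr_ge0 W; rewrite /N; lra.
(* The bound is affine in s, with s in [0, P * W]: the second term of the
   maximum handles the extremal value s = 0, the first one s = P * W. *)
have [hb|hb] := leP (2 - lam) (1 + b ^+ 2).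
  apply: (@le_trans _ _
    ((1 - lam * (2 - lam) * (1 / (1 + b ^+ 2))) * N)); last first.
    by rewrite ler_wpM2r// le_max lexx orbT.
  set d := 1 / (1 + b ^+ 2).
  have b2 : 0 < 1 + b ^+ 2 by rewrite ltr_pwDl// sqr_ge0.
  have d0 : 0 < d by rewrite divr_gt0.
  have dE : d * (1 + b ^+ 2) = 1 by rewrite /d mul1r mulVf// gt_eqF.
  have PW : P ^+ 2 <= b ^+ 2 * W ^+ 2.
    by rewrite -exprMn ler_sqr ?nnegrE// mulr_ge0.
  have h1 : lam * (2 - lam) * d * (P ^+ 2 + W ^+ 2) <= lam * (2 - lam) * W ^+ 2.
    rewrite -(mulrA _ d); apply: ler_wpM2l; first by apply: mulr_ge0; lra.
    apply: (@le_trans _ _ (d * ((1 + b ^+ 2) * W ^+ 2))).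
      by apply: ler_wpM2l; [exact: ltW|lra].
    by rewrite mulrA dE mul1r.
  (* Since [(2 - lam) * d <= 1], the difference of the two sides of the goal is largest at
     [s = 0]. *)
  have h2 : lam * (2 * s) * ((2 - lam) * d) <= lam * (2 * s) * 1.
    apply: ler_wpM2l; first by do ?apply: mulr_ge0; lra.
    by rewrite -[leRHS]dE mulrC ler_wpM2l// ltW.
  rewrite /N; lra.
apply: (@le_trans _ _ ((1 - lam / (b + 1)) ^+ 2 * N)); last first.
  by rewrite ler_wpM2r// le_max lexx.
set t := lam / (b + 1).
have tE : t * (b + 1) = lam by rewrite /t divfK// gt_eqF//; lra.
have t0 : 0 <= t by rewrite divr_ge0//; lra.
have q0 : 0 <= (1 - lam) - b ^+ 2 by lra.
have k0 : 0 <= 1 - t.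
  rewrite subr_ge0 /t ler_pdivrMr; last lra.
  have := sqr_ge0 b; lra.
(* Here [b ^+ 2 < 1 - lam]; this comparison of the coefficients of [s] makes [s = P * W] the worst
   case, settled by [h2]. *)
have key : (1 - t) ^+ 2 <= 1 - lam.
  have : 0 <= t * (1 - lam - b ^+ 2) / (b + 1).
    by apply: divr_ge0; [exact: mulr_ge0|lra].
  have -> : t * (1 - lam - b ^+ 2) / (b + 1) = 1 - lam - (1 - t) ^+ 2.
    rewrite /t; field; rewrite gt_eqF//; lra.
  lra.
have h1 : P + (1 - lam) * W <= (1 - t) * (P + W).
  have : 0 <= t * (b * W - P) by rewrite mulr_ge0// subr_ge0.
  rewrite -tE; lra.
have h2 : (P + (1 - lam) * W) ^+ 2 <= ((1 - t) * (P + W)) ^+ 2.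
  have q1 : 0 <= 1 - lam by have := sqr_ge0 b; lra.
  have PW0 : 0 <= P + (1 - lam) * W by rewrite addr_ge0// mulr_ge0.
  by rewrite ler_sqr ?nnegrE// (le_trans PW0).
have h3 : 0 <= (P * W - s) * (1 - lam - (1 - t) ^+ 2).
  by rewrite mulr_ge0 ?subr_ge0.
rewrite /N; lra.
Qed.

End Step.

(** * Convergence of the inexact iteration *)

Theorem proposition5p10 (R : realType)
  (* (H, ip) is a real Hilbert space: the complete norm of H is induced by ip *)
  (H : completeNormedModType R) (ip : {dot H for idfun})
  (norm_ip : forall z : H, `|z| ^+ 2 = ip z z)
  (A : H -> set H) (maxA : maximally_monotone ip A) (zerA : zer A !=set0)
  (x : nat -> H) (lambda eta c : nat -> R) (e : nat -> H)
  (lambda02 : forall k, 0 < lambda k < 2)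
  (eta_ge0 : forall k, 0 <= eta k)
  (c_gt0 : forall k, 0 < c k)
  (xS : forall k, x k.+1 = (1 - lambda k) *: x k
     + lambda k *: resolvent (c k) A (x k) + eta k *: e k)
  (alpha : R) (xbar : H) (alpha_gt0 : 0 < alpha)
  (lipA : lipschitz_at0 (inverse A) alpha xbar)
  (sum_e : (\sum_(0 <= k <oo) (eta k * `|e k|)%:E < +oo)%E)
  (eps : nat -> R) (eps_ge0 : forall k, 0 <= eps k)
  (eta_eps : eta k * eps k @[k --> \oo] --> (0 : R))
  (e_le : forall k, `|e k| <= eps k * `|x k - x k.+1|)
  (c_liminf : (0 < limn_einf (fun k => (c k)%:E))%E)
  (lambda_liminf : (0 < limn_einf (fun k => (lambda k)%:E))%E)
  (lambda_limle : (limn_einf (fun k => (lambda k)%:E)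
                   <= limn_esup (fun k => (lambda k)%:E))%E)
  (lambda_limsup : (limn_esup (fun k => (lambda k)%:E) < 2%:E)%E)
  (rho : nat -> R)
  (rhoE : forall k, rho k = Num.sqrt (Num.max
     ((1 - lambda k / (alpha / c k + 1)) ^+ 2)
     (1 - lambda k * (2 - lambda k) * (1 / (1 + alpha ^+ 2 / c k ^+ 2))))) :
  (\forall k \near \oo, `|x k.+1 - xbar|
     <= (rho k + eta k * eps k) / (1 - eta k * eps k) * `|x k - xbar|)
  /\
  (exists mu : R, exists K : nat, 0 <= mu < 1 /\
     forall k, (K <= k)%N ->
       `|x k.+1 - xbar| <= mu * `|x k - xbar| /\
       mu * `|x k - xbar| <= mu ^+ (k - K + 1)%N * `|x K - xbar|).
Proof.
pose J k := resolvent (c k) A (x k).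
pose p k := J k - xbar; pose w k := x k - J k.
pose a k := `|x k - xbar|; pose d k := eta k * `|e k|.
pose y k := p k + (1 - lambda k) *: w k.
case: lipA => Abar [tau tau0 lip].
have Axbar : A xbar 0.
  have : inverse A 0 xbar by rewrite Abar.
  by [].
have AJ k : A (J k) ((c k)^-1 *: w k) by exact: resolventP.
have pw0 k : 0 <= ip (p k) (w k).
  have := maxA.1 _ _ _ _ (AJ k) Axbar.
  by rewrite subr0 ipZr pmulr_rge0 ?invr_gt0.
have xE k : x k - xbar = p k + w k by rewrite /p /w [RHS]addrC addrA subrK.
have xSE k : x k.+1 - xbar = y k + eta k *: e k.
  rewrite xS addrAC; congr (_ + _); rewrite /y /p /w -/(J k).
  rewrite scalerBr (scalerBl _ _ (J k)) scale1r opprB [RHS]addrC -!addrA.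
  by rewrite addKr.
have a0 k : 0 <= a k by exact: normr_ge0.
have d0 k : 0 <= d k by rewrite mulr_ge0.
have a_sqr k : a k ^+ 2 = `|p k| ^+ 2 + 2 * ip (p k) (w k) + `|w k| ^+ 2.
  by rewrite /a xE -[w k in LHS]scale1r (sqr_norm_add norm_ip); ring.
have y_sqr k : `|y k| ^+ 2 <= a k ^+ 2 - lambda k * (2 - lambda k) * `|w k| ^+ 2.
  rewrite a_sqr (sqr_norm_add norm_ip).
  have : 0 <= lambda k * ip (p k) (w k).
    by rewrite mulr_ge0// ltW//; case/andP: (lambda02 k).
  lra.
have ya k : `|y k| <= a k.
  rewrite -ler_sqr ?nnegrE//; apply: le_trans (y_sqr k) _.
  rewrite gerBl mulr_ge0 ?sqr_ge0//.
  by have /andP[l0 l2] := lambda02 k; apply: mulr_ge0; lra.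
have aSy k : a k.+1 <= `|y k| + d k.
  by rewrite /a xSE (le_trans (ler_normD _ _))// normrZ ger0_norm.
have cd : cvgn (series d) by exact: nnseries_is_cvg.
have ca : cvgn a.
  apply: (quasi_nonincreasing_is_cvgn (d := d)) => // k.
  by apply: le_trans (aSy k) _; rewrite lerD2r.
(* [g k] dominates [a k ^+ 2 - |y k|^2] after factoring: the first factor uses [aSy], the second
   [ya]. *)
pose g k := (a k - a k.+1 + d k) * (2 * a k).
have g0 : g @ \oo --> (0 : R).
  have -> : (0 : R) = (limn a - limn a + 0) * (2 * limn a).
    by rewrite subrr addr0 mul0r.
  have caS : a \o S @ \oo --> limn a by rewrite (cvg_shiftS a).
  apply: cvgM; last exact: cvgMr.
  by apply: cvgD; [exact: cvgB|exact: cvg_series_cvg_0].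
have wg k : lambda k * (2 - lambda k) * `|w k| ^+ 2 <= g k.
  apply: (@le_trans _ _ ((a k - `|y k|) * (a k + `|y k|))).
    have := y_sqr k; lra.
  apply: ler_pM; rewrite ?subr_ge0 ?addr_ge0//.
    have := aSy k; lra.
  have := ya k; lra.
have [c0 c00 cge] := limn_einf_gt_near c_liminf.
have [l l0 lge] := limn_einf_gt_near lambda_liminf.
have [h h2 lle] := limn_esup_lt_near lambda_limsup.
(* Dividing by [c k >= c0] then puts [w k / c k] in the ball of radius [tau]. *)
have w_small : \forall k \near \oo, `|w k| <= tau * c0.
  pose D := l * (2 - h) * (tau * c0) ^+ 2.
  have D0 : 0 < D by rewrite !mulr_gt0 ?subr_gt0// exprn_gt0// mulr_gt0.
  near=> k.
  have lk : l <= lambda k by near: k.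
  have hk : lambda k <= h by near: k.
  have gk : g k <= D.
    apply: ltW; near: k; exact: (cvgr_lt 0).
  have tc0 : 0 <= tau * c0 by exact/ltW/mulr_gt0.
  rewrite -ler_sqr ?nnegrE//.
  have lh : 0 < l * (2 - h) by rewrite mulr_gt0// subr_gt0.
  rewrite -(ler_pM2l lh); apply: le_trans gk; apply: le_trans (wg k).
  by rewrite ler_wpM2r ?sqr_ge0//; apply: ler_pM; lra.
have i : \forall k \near \oo, `|x k.+1 - xbar|
     <= (rho k + eta k * eps k) / (1 - eta k * eps k) * `|x k - xbar|.
  near=> k.
  have ck : c0 <= c k by near: k.
  have t1 : eta k * eps k < 1 by near: k; exact: (cvgr_lt 0).
  have wk : `|w k| <= tau * c0 by near: k.
  set t := eta k * eps k in t1 *.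
  have t0 : 0 <= t by rewrite mulr_ge0.
  have nJ : `|(c k)^-1 *: w k| = `|w k| / c k.
    by rewrite normrZ gtr0_norm ?invr_gt0// mulrC.
  have pk : `|p k| <= alpha / c k * `|w k|.
    rewrite mulrAC -mulrA -nJ; apply: lip; first exact: AJ.
    rewrite nJ ler_pdivrMr//; apply: le_trans wk _.
    by rewrite ler_wpM2l// ltW.
  have yk : `|y k| <= rho k * a k.
    rewrite rhoE -expr_div_n /a xE; apply: (relaxed_step_le norm_ip) => //.
    by rewrite divr_ge0// ltW.
  (* The triangle inequality through [xbar] brings in [a k.+1]; as [t < 1], that term is absorbed on
     the left, producing the denominator [1 - t]. *)
  have ek : d k <= t * (a k + a k.+1).
    rewrite /d /t -mulrA ler_wpM2l//; apply: le_trans (e_le k) _.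
    rewrite ler_wpM2l// /a (le_trans _ (ler_normB _ _))//.
    by rewrite opprB addrA subrK.
  rewrite mulrAC ler_pdivlMr ?subr_gt0// -/(a _) -/(a _).
  have := aSy k; lra.
split => //.
have B0 : 0 <= alpha / c0 by rewrite divr_ge0// ltW.
have [r /andP[r0 r1] rhor] := rate_le l0 h2 B0.
pose mu := (1 + r) / 2.
have mu0 : 0 <= mu by rewrite /mu; lra.
have [K _ hK] : \forall k \near \oo, a k.+1 <= mu * a k.
  near=> k.
  have ik : a k.+1 <= (rho k + eta k * eps k) / (1 - eta k * eps k) * a k.
    by near: k.
  have ck : c0 <= c k by near: k.
  have lk : l <= lambda k by near: k.
  have hk : lambda k <= h by near: k.
  have rk : rho k <= r.
    rewrite rhoE -expr_div_n; apply: rhor; last by rewrite lk.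
    apply/andP; split; first by apply: divr_ge0; exact: ltW.
    by rewrite ler_pM2l// lef_pV2 ?posrE.
  (* With [t] for this product, [r + t + mu * t <= r + 2 * t <= (1 + r) / 2 = mu], so the quotient
     is at most [mu]. *)
  have tk : eta k * eps k < (1 - r) / 4.
    by near: k; apply: (cvgr_lt 0) => //; lra.
  apply: le_trans ik _; apply: ler_wpM2r => //.
  have t0 : 0 <= eta k * eps k by rewrite mulr_ge0.
  rewrite ler_pdivrMr; last lra.
  have : mu * (eta k * eps k) <= 1 * (eta k * eps k).
    by apply: ler_wpM2r => //; rewrite /mu; lra.
  rewrite /mu; lra.
exists mu, K; split; first by rewrite mu0 /mu; lra.
move=> k Kk; split; first exact: hK.
rewrite addn1 exprS -mulrA; apply: ler_wpM2l => //.
rewrite -(subnK Kk); elim: (k - K)%N => [|n IH].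
  by rewrite add0n subnn expr0 mul1r.
have Kn : (K <= n + K)%N by rewrite leq_addl.
rewrite addSn subSn// exprS -mulrA; apply: le_trans (hK _ Kn) _.
exact: ler_wpM2l.
Unshelve. all: by end_near. Qed.
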